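(* Let $k\ge 2$, let $n_1<n_2<\cdots<n_k$ be positive integers with $\gcd(n_1,\ldots,n_k)=1$, and let $S=\langle n_1,\ldots,n_k\rangle$. Let $j\ge 1$ be an integer. Then there exists $N$ such that for every $n\in S$ with $n\ge N$, if $i\in\{0,\ldots,n_1-1\}$ is given by $n\equiv i\bmod n_1$, then $\mathsf M_j(n)$ is defined and $$\mathsf M_j(n)=\frac{n-b_{ij}}{n_1}.$$
   Context: For positive integers $g_1,\ldots,g_r$, $\langle g_1,\ldots,g_r\rangle=\{q_1g_1+\cdots+q_rg_r : q_l\in\mathbb Z_{\ge 0}\}$. The generators $n_1,\ldots,n_k$ of $S$ are fixed and need not be a minimal generating set. For $n\in S$, the length set is $\mathsf L(n)=\{q_1+\cdots+q_k : q_1,\ldots,q_k\in\mathbb Z_{\ge 0},\ n=q_1n_1+\cdots+q_kn_k\}$. If $|\mathsf L(n)|\ge j$, then $\mathsf M_j(n)$ denotes the $j$-th largest element of $\mathsf L(n)$ (so $\mathsf M_1(n)=\max \mathsf L(n)$). Let $S_{\mathsf M}=\langle n_2-n_1,n_3-n_1,\ldots,n_k-n_1\rangle$. Since $\gcd(\gcd(S_{\mathsf M}),n_1)=1$, $S_{\mathsf M}$ contains infinitely many elements of every residue class modulo $n_1$. For $0\le i<n_1$ and $j\ge 1$, $b_{ij}$ denotes the $j$-th smallest element of $\{b\in S_{\mathsf M} : b\equiv i\bmod n_1\}$. *)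

(* Defs.v *)
From mathcomp Require Import all_boot all_order all_algebra.
From mathcomp Require Import boolp classical_sets functions cardinality.

Set Implicit Arguments.
Unset Strict Implicit.
Unset Printing Implicit Defensive.

Local Open Scope classical_set_scope.
Local Open Scope card_scope.

Definition semigroup (r : nat) (g : r.-tuple nat) : set nat :=
  [set x | exists q : 'I_r -> nat, x = \sum_(l < r) q l * tnth g l].

Definition lengths (r : nat) (g : r.-tuple nat) (x : nat) : set nat :=
  [set len | exists q : 'I_r -> nat,
     len = \sum_(l < r) q l /\ x = \sum_(l < r) q l * tnth g l].

(* Ranks start at 1: exactly j - 1 elements of A lie beyond m. The predicates
   hold for at most one m when 0 < j; the functions below return 0 when A has
   no j-th largest (resp. smallest) element. *)
Definition is_jth_largest (A : set nat) (j m : nat) : Prop :=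
  A m /\ [set a | A a /\ m < a] #= `I_j.-1.

Definition is_jth_smallest (A : set nat) (j m : nat) : Prop :=
  A m /\ [set a | A a /\ a < m] #= `I_j.-1.

Definition jth_largest (A : set nat) (j : nat) : nat :=
  xget 0 [set m | is_jth_largest A j m].

Definition jth_smallest (A : set nat) (j : nat) : nat :=
  xget 0 [set m | is_jth_smallest A j m].

(* M_j(x), meaningful when the length set of x has at least j elements. *)
Definition M_len (r : nat) (g : r.-tuple nat) (j x : nat) : nat :=
  jth_largest (lengths g x) j.

Definition first_gen (r : nat) (g : r.-tuple nat) : nat := head 0 g.

Definition S_M (r : nat) (g : r.-tuple nat) : set nat :=
  semigroup [tuple of [seq x - first_gen g | x <- behead g]].

Definition b_res (r : nat) (g : r.-tuple nat) (i j : nat) : nat :=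
  jth_smallest [set x | S_M g x /\ x = i %[mod first_gen g]] j.

(* Main.v *)
(** Writing n_l = n_1 + d_l, a factorization of n of length len is the same as
    an equality n = len n_1 + b, where b is a sum of at most len differences
    d_l. Since d_l > 0, any b in S_M uses at most b differences, so the bound on
    their number is automatic when b <= len, which for fixed b holds for all
    large n. Hence the j largest lengths correspond to the j smallest elements
    of S_M congruent to n modulo n_1. *)

Require Import Defs.
From mathcomp Require Import all_boot all_order all_algebra.
From mathcomp Require Import boolp classical_sets functions cardinality.
From mathcomp Require Import zify.

Local Open Scope classical_set_scope.
Local Open Scope card_scope.

Lemma card_setU1_II (A : set nat) (x n : nat) :
  A #= `I_n -> ~ A x -> (x |` A) #= `I_n.+1.
Proof.
move=> An nAx; apply/eq_cardSP; exists x; first by left.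
suff -> : (x |` A) `\ x = A by [].
apply/seteqP; split=> y /=; first by case=> -[->|].
by move=> Ay; split; [right|move=> yx; apply: nAx; rewrite -yx].
Qed.

(** Induction on the number [p] of smaller elements: the least element of [A] beyond the current [m]
    has exactly one more element of [A] below it, namely [m]. *)
Lemma is_jth_smallest_exists (A : set nat) (j : nat) :
  (forall x, exists2 a, A a & x <= a) -> exists m, is_jth_smallest A j m.
Proof.
move=> Ainf.
have next x : exists m, [/\ A m, x <= m & forall a, A a -> x <= a -> m <= a].
  have exA : exists a, `[< A a >] && (x <= a).
    by have [a Aa xa] := Ainf x; exists a; rewrite xa andbT; apply/asboolP.
  case: (ex_minnP exA) => m /andP[/asboolP Am xm] m_min; exists m; split=> //.
  by move=> a Aa xa; apply: m_min; rewrite xa andbT; apply/asboolP.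
suff H p : exists m, A m /\ [set a | A a /\ a < m] #= `I_p by exact: H.
elim: p => [|p [m [Am mcard]]].
  have [m [Am _ m_min]] := next 0; exists m; split=> //.
  suff -> : [set a | A a /\ a < m] = set0 by rewrite II0.
  by apply/seteqP; split=> // a [Aa am]; have := m_min a Aa isT; lia.
have [m' [Am' mm' m'_min]] := next m.+1; exists m'; split=> //.
suff -> : [set a | A a /\ a < m'] = m |` [set a | A a /\ a < m].
  by apply: card_setU1_II => // -[_]; rewrite ltnn.
apply/seteqP; split=> a /=.
  case=> Aa am'; have [am|ma|->] := ltngtP a m; [by right| |by left].
  by have := m'_min a Aa ma; lia.
by case=> [->|[Aa am]]; split=> //; lia.
Qed.

Lemma is_jth_largest_card {A : set nat} {j m : nat} :
  is_jth_largest A j m -> [set a | A a /\ m <= a] #= `I_j.-1.+1.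
Proof.
case=> Am mcard.
suff -> : [set a | A a /\ m <= a] = m |` [set a | A a /\ m < a].
  by apply: card_setU1_II => // -[_]; rewrite ltnn.
apply/seteqP; split=> a /=.
  by case=> Aa; rewrite leq_eqVlt => /orP[/eqP ->|ma]; [left|right].
by case=> [->|[Aa ma]]; split=> //; exact: ltnW.
Qed.

Lemma is_jth_largest_unique (A : set nat) (j m m' : nat) :
  is_jth_largest A j m -> is_jth_largest A j m' -> m = m'.
Proof.
move=> mP m'P.
(* If [u < v], the [j.-1.+1] elements that are at least [v] all lie among the [j.-1] elements beyond
   [u]. *)
have nlt u v : is_jth_largest A j u -> is_jth_largest A j v -> ~ u < v.
  move=> [_ ucard] /is_jth_largest_card vcard uv.
  suff : `I_j.-1.+1 #<= `I_j.-1 by rewrite card_le_II ltnn.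
  move: ucard vcard; rewrite !card_eq_le => /andP[ule _] /andP[_ vle].
  apply: (card_le_trans vle); apply: card_le_trans ule.
  by apply: subset_card_le => a /= [Aa va]; split=> //; exact: leq_trans va.
by have := nlt m m' mP m'P; have := nlt m' m m'P mP; lia.
Qed.

Lemma jth_largestE {A : set nat} {j m : nat} :
  is_jth_largest A j m -> jth_largest A j = m.
Proof.
move=> mP; apply: xget_unique => // m' m'P; exact: is_jth_largest_unique m'P mP.
Qed.

(** Modulo [m], the negative Bezout coefficient [- c] can be replaced by the natural number
    [c * m.-1]. *)
Lemma Bezout_modn (a b m : nat) :
  0 < m -> exists u v, u * a + v * b = gcdn a b %[mod m].
Proof.
move=> m_gt0; have [->|a_gt0] := posnP a.
  by exists 0, 1; rewrite gcd0n mul1n.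
have [c _ /dvdnP[u def_u]] := Bezoutl b a_gt0.
exists u, (c * m.-1); rewrite -def_u -addnA.
have -> : c * b + c * m.-1 * b = c * b * m by case: m m_gt0 => // m _ /=; lia.
by rewrite addnC modnMDl.
Qed.

Lemma big_Bezout_modn (r : nat) (d : 'I_r -> nat) (m : nat) : 0 < m ->
  exists q : 'I_r -> nat,
    \sum_(l < r) q l * d l = \big[gcdn/0]_(l < r) d l %[mod m].
Proof.
move=> m_gt0; elim: r d => [|r IHr] d.
  by exists (fun=> 0); rewrite !big_ord0.
have [q def_q] := IHr (fun l => d (lift ord0 l)).
have [u [v def_uv]] :=
  Bezout_modn (d ord0) (\big[gcdn/0]_(l < r) d (lift ord0 l)) _ m_gt0.
exists (fun l => if unlift ord0 l is Some l' then v * q l' else u).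
rewrite !big_ord_recl /= unlift_none -def_uv.
under eq_bigr => l _ do rewrite liftK -mulnA.
by rewrite -big_distrr /= -modnDmr -modnMmr def_q modnMmr modnDmr.
Qed.

Section Consing.

Context {r : nat} (n1 : nat) (t : r.-tuple nat).

Lemma S_M_consE (x : nat) :
  S_M [tuple of n1 :: t] x <->
  exists q : 'I_r -> nat, x = \sum_(l < r) q l * (tnth t l - n1).
Proof.
rewrite /S_M /semigroup /=; split=> -[q ->]; exists q; apply: eq_bigr => l _;
  by rewrite !(tnth_nth 0) /= (nth_map 0) ?size_tuple.
Qed.

Hypothesis t_ge : forall l, n1 <= tnth t l.

Lemma sum_mul_gens (q : 'I_r -> nat) :
  \sum_(l < r) q l * tnth t l =
  (\sum_(l < r) q l) * n1 + \sum_(l < r) q l * (tnth t l - n1).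
Proof.
rewrite big_distrl -big_split /=; apply: eq_bigr => l _.
by rewrite -mulnDr subnKC.
Qed.

(* The free coefficient of [n1] absorbs the slack between [len] and the
   number of differences used. *)
Lemma lengths_consE (n len : nat) :
  lengths [tuple of n1 :: t] n len <->
  exists2 q : 'I_r -> nat, \sum_(l < r) q l <= len
    & n = len * n1 + \sum_(l < r) q l * (tnth t l - n1).
Proof.
split=> [[q [-> ->]]|[q q_le ->]].
  exists (fun l => q (lift ord0 l)); rewrite !big_ord_recl ?leq_addl //=.
  rewrite tnth0; under eq_bigr => l _ do rewrite tnthS.
  by rewrite sum_mul_gens mulnDl addnA.
have sumE := sum_mul_gens q; set s := \sum_(l < r) q l in q_le sumE.
exists (fun l => if unlift ord0 l is Some l' then q l' else len - s).
rewrite !big_ord_recl /= unlift_none tnth0.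
under eq_bigr => l _ do rewrite liftK.
under [X in _ /\ _ = _ + X]eq_bigr => l _ do rewrite liftK tnthS.
by rewrite subnK // sumE addnA -mulnDl subnK.
Qed.

End Consing.

Section Asymptotics.

Context {r : nat} {n1 : nat} {t : r.-tuple nat}.
Hypothesis n1_gt0 : 0 < n1.
Hypothesis t_gt : forall l, n1 < tnth t l.
Local Notation g := [tuple of n1 :: t].

(** Modulo [n1] the generator [n1] vanishes and every other generator equals its difference with
    [n1], so Bezout yields a combination of differences congruent to 1. *)
Lemma S_M_residue_unbounded (i : nat) :
  0 < r -> \big[gcdn/0]_(l < r.+1) tnth g l = 1 ->
  forall x, exists2 b, S_M g b /\ b = i %[mod n1] & x <= b.
Proof.
move=> r_gt0 g_gcd x.
have [q] := big_Bezout_modn r.+1 (fun l => tnth g l) n1 n1_gt0.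
rewrite g_gcd big_ord_recl tnth0 modnMDl.
under eq_bigr => l _ do rewrite tnthS.
rewrite (sum_mul_gens n1) ?modnMDl; last by move=> l; exact: ltnW.
move=> q1.
(* The factor [i] moves the residue 1 to [i]; the summand [n1 * x] keeps the residue and makes a
   single term already at least [x]. *)
pose q' l := i * q (lift ord0 l) + n1 * x.
exists (\sum_(l < r) q' l * (tnth t l - n1)).
  split; first by apply/S_M_consE; exists q'.
  rewrite /q'; under eq_bigr => l _ do rewrite mulnDl -!mulnA.
  rewrite big_split -!big_distrr /= addnC mulnC modnMDl.
  by rewrite -modnMmr q1 modnMmr muln1.
rewrite (bigD1 (Ordinal r_gt0)) //= (leq_trans _ (leq_addr _ _)) //.
apply: (@leq_trans (q' (Ordinal r_gt0))).
  by rewrite (leq_trans _ (leq_addl _ _)) // leq_pmull.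
by rewrite leq_pmulr // subn_gt0.
Qed.

Lemma S_M_lengths (b len : nat) :
  S_M g b -> b <= len -> lengths g (len * n1 + b) len.
Proof.
move=> /S_M_consE[q def_b] b_le; apply/lengths_consE.
  by move=> l; exact: ltnW.
exists q; last by rewrite def_b.
apply: leq_trans b_le; rewrite def_b; apply: leq_sum => l _.
by rewrite leq_pmulr // subn_gt0.
Qed.

Lemma lengths_S_M (n len : nat) :
  lengths g n len -> exists2 b, S_M g b & n = len * n1 + b.
Proof.
move=> /lengths_consE[l|q _ def_n]; first exact: ltnW.
by exists (\sum_(l < r) q l * (tnth t l - n1)) => //; apply/S_M_consE; exists q.
Qed.

(* [len |-> n - len * n1] reverses the order and maps the top of the length
   set onto the bottom of the residue class of [n] in [S_M]. *)
Lemma is_jth_largest_lengths (i j b m : nat) :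
  is_jth_smallest [set x | S_M g x /\ x = i %[mod n1]] j b ->
  b <= m -> is_jth_largest (lengths g (m * n1 + b)) j m.
Proof.
set B := [set x | _]; move=> [[Sb bi] bcard] b_le; split; first exact: S_M_lengths.
set n := m * n1 + b; pose f len := n - len * n1.
have flt len : lengths g n len -> n = len * n1 + f len.
  by move=> /lengths_S_M[c _ def_n]; rewrite /f; lia.
(* Subtraction is exact on lengths of [n], so [f] is injective there; it remains to identify the
   image of the lengths beyond [m]. *)
apply: card_eq_trans bcard; suff <- : f @` [set a | lengths g n a /\ m < a]
          = [set x | B x /\ x < b].
  rewrite card_eq_sym; apply: inj_card_eq => a a'.
  rewrite !inE => -[/flt na _] [/flt na' _] faa'.
  by apply/eqP; rewrite -(eqn_pmul2r n1_gt0); apply/eqP; lia.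
have n_mod : n = i %[mod n1] by rewrite /n modnMDl.
apply/seteqP; split=> [_ [a /= [La ma] <-]|x /= [[Sx xi] xb]].
  have [c Sc def_n] := lengths_S_M _ _ La.
  have -> : f a = c by rewrite /f; lia.
  split; first by split=> //; rewrite -n_mod def_n modnMDl.
  suff : m * n1 + n1 <= a * n1 by rewrite /n in def_n; lia.
  by rewrite addnC -mulSn leq_pmul2r.
(* Conversely, [x] comes from the length [m + c] with [b - x = c * n1]; this is a length because
   [x < b <= m]. *)
have /dvdnP[c def_c] : n1 %| b - x.
  by rewrite -eqn_mod_dvd 1?ltnW // bi xi.
have c_gt0 : 0 < c by case: c def_c => [|c] // def_c; lia.
have def_n : n = (m + c) * n1 + x by rewrite /n; lia.
exists (m + c); last by rewrite /f; lia.
split; last by lia.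
by rewrite def_n; apply: S_M_lengths => //; lia.
Qed.

End Asymptotics.

Theorem theorem3p3 (k : nat) (hk : 2 <= k) (g : k.-tuple nat)
    (g_pos : forall l : 'I_k, 0 < tnth g l)
    (g_incr : forall l m : 'I_k, l < m -> tnth g l < tnth g m)
    (g_gcd : \big[gcdn/0]_(l < k) tnth g l = 1)
    (j : nat) (hj : 1 <= j) :
  exists N : nat, forall n : nat, semigroup g n -> N <= n ->
    forall i : nat, i < first_gen g -> n = i %[mod first_gen g] ->
      `I_j #<= lengths g n /\
      ((M_len g j n)%:R = (n%:R - (b_res g i j)%:R) / (first_gen g)%:R :> rat)%R.
Proof.
case: k hk g g_pos g_incr g_gcd => // r r_gt0 g.
case/tupleP: g => n1 t g_pos g_incr g_gcd.
have n1_gt0 : 0 < n1 by have := g_pos ord0; rewrite tnth0.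
have t_gt l : n1 < tnth t l.
  by have := g_incr ord0 (lift ord0 l) isT; rewrite tnth0 tnthS.
rewrite /first_gen /=; set g := [tuple of n1 :: t].
pose b (i : nat) := b_res g i j.
have bP i : is_jth_smallest [set x | S_M g x /\ x = i %[mod n1]] j (b i).
  (* Existence rules out the default value 0 of [b_res]. *)
  apply: (xgetPex 0); apply: is_jth_smallest_exists => x.
  by apply: S_M_residue_unbounded.
(* From [b i * n1.+1 <= n = m * n1 + b i] follows [b i <= m]; the maximum makes the bound uniform in
   the residue. *)
exists (\max_(i < n1) b i * n1.+1) => n _ n_ge i i_lt n_mod.
have bi_le : b i * n1.+1 <= n.
  apply: leq_trans n_ge.
  exact: (leq_bigmax (F := fun l : 'I_n1 => b l * n1.+1) (Ordinal i_lt)).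
have /dvdnP[m def_m] : n1 %| n - b i.
  have [[_ bi] _] := bP i.
  by rewrite -eqn_mod_dvd ?bi ?n_mod //; lia.
have def_n : n = m * n1 + b i by lia.
have b_le : b i <= m by rewrite -(leq_pmul2r n1_gt0); lia.
have := is_jth_largest_lengths n1_gt0 t_gt i j _ _ (bP i) b_le.
rewrite -def_n => mP; split.
  (* The lengths that are at least [m] already number [j]. *)
  have := is_jth_largest_card mP; rewrite prednK // card_eq_le => /andP[_ jle].
  by apply: card_le_trans jle _; apply: subset_card_le => a [].
rewrite /M_len (jth_largestE mP) -/(b i) def_n GRing.natrD GRing.natrM.
rewrite GRing.addrK GRing.mulfK // Num.Theory.pnatr_eq0; lia.
Qed.
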